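(* Let $r\in C^1(\mathbb R)$ and $R_0$ be a constant with $|r(t)|,|r'(t)|\le R_0$ for all $t\in\mathbb R$. For $(\sigma,b)\in(0,\infty)^2$ consider the non-autonomous Lorenz system $x'=-\sigma x+\sigma y$, $y'=r(t)x-y-xz$, $z'=-bz+xy$, with its process $S_{\sigma,b}$ on $\mathbb R^3$, pullback attractor $\mathscr A_{\sigma,b}(\cdot)$ and uniform attractor $\mathbb A_{\sigma,b}$. There is a residual and dense subset $\Lambda_*\subseteq(0,\infty)^2$ such that the maps $(0,\infty)^2\to CB(\mathbb R^3)$ given by $(\sigma,b)\mapsto\mathscr A_{\sigma,b}(t)$ (for every $t\in\mathbb R$) and $(\sigma,b)\mapsto\mathbb A_{\sigma,b}$ are continuous at every point of $\Lambda_*$.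
   Context: For each $(\sigma,b)$ the system generates a process $S(t,s)$ on $\mathbb R^3$ ($S(t,s)v_0$ is the solution at time $t$ starting from $v_0$ at time $s$), which has a pullback attractor and a uniform attractor. With $\rho(A,C)=\sup_{a\in A}\inf_{c\in C}|a-c|$: a family of compact sets $\mathscr A(\cdot)$ is the pullback attractor if $S(t,s)\mathscr A(s)=\mathscr A(t)$ for $t\ge s$, $\rho(S(t,s)B,\mathscr A(t))\to0$ as $s\to-\infty$ for every bounded $B$ and $t$, and it is minimal among such families; the uniform attractor is the minimal compact set $\mathbb A$ with $\lim_{t\to\infty}\sup_{s\in\mathbb R}\rho(S(t+s,s)B,\mathbb A)=0$ for every bounded $B$. $CB(\mathbb R^3)$ is the space of nonempty closed bounded subsets with Hausdorff metric $\max(\rho(A,C),\rho(C,A))$. Residual means the complement is a countable union of nowhere dense sets. *)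

(* Defs.v *)
From HB Require Import structures.
From mathcomp Require Import all_boot all_order all_algebra.
From mathcomp Require Import all_classical all_reals all_analysis.
Set Implicit Arguments. Unset Strict Implicit. Unset Printing Implicit Defensive.
Import Order.TTheory GRing.Theory Num.Theory.
Import numFieldNormedType.Exports.
Local Open Scope classical_set_scope.
Local Open Scope ring_scope.

Section Defs.
Variable R : realType.

Definition V3 := (R * R * R)%type.
Definition V2 := (R * R)%type.

Definition dist3 (u v : V3) : R :=
  Num.sqrt ((u.1.1 - v.1.1) ^+ 2 + (u.1.2 - v.1.2) ^+ 2 + (u.2 - v.2) ^+ 2).
Definition dist2 (p q : V2) : R :=
  Num.sqrt ((p.1 - q.1) ^+ 2 + (p.2 - q.2) ^+ 2).

Definition bounded3 (B : set V3) : Prop :=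
  exists M : R, forall x, B x -> dist3 x (0, 0, 0) <= M.

(* inf_{c in C} |x - c|  (= +oo if C is empty) *)
Definition dist_pt (x : V3) (C : set V3) : \bar R :=
  ereal_inf [set (dist3 x c)%:E | c in C].

Definition semidist (A C : set V3) : \bar R :=
  ereal_sup [set dist_pt a C | a in A].

Definition hausdorff (A C : set V3) : \bar R :=
  Order.max (semidist A C) (semidist C A).

Definition lorenz_process (r : R -> R) (sigma b : R)
    (S : R -> R -> V3 -> V3) : Prop :=
  forall (s : R) (v0 : V3),
    let u := fun t => S t s v0 in
    u s = v0 /\
    (u t @[t --> s^'+] --> v0) /\
    (forall t, s < t ->
       is_derive t 1 (fun tau => (u tau).1.1)
         (- sigma * (u t).1.1 + sigma * (u t).1.2) /\
       is_derive t 1 (fun tau => (u tau).1.2)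
         (r t * (u t).1.1 - (u t).1.2 - (u t).1.1 * (u t).2) /\
       is_derive t 1 (fun tau => (u tau).2)
         (- b * (u t).2 + (u t).1.1 * (u t).1.2)).

Definition pullback_attracting (S : R -> R -> V3 -> V3) (C : R -> set V3) : Prop :=
  forall B : set V3, bounded3 B -> forall t (eps : R), 0 < eps ->
    exists s0 : R, forall s, s <= s0 -> s <= t ->
      (semidist (S t s @` B) (C t) < eps%:E)%E.

Definition pullback_attractor (S : R -> R -> V3 -> V3) (A : R -> set V3) : Prop :=
  [/\ (forall t, compact (A t)),
      (forall t s, s <= t -> S t s @` A s = A t),
      pullback_attracting S A &
      (forall C : R -> set V3, (forall t, compact (C t)) ->
         pullback_attracting S C -> forall t, A t `<=` C t)].

Definition uniformly_attracting (S : R -> R -> V3 -> V3) (K : set V3) : Prop :=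
  forall B : set V3, bounded3 B -> forall eps : R, 0 < eps ->
    exists T : R, forall t, T <= t ->
      (ereal_sup [set semidist (S (t + s)%R s @` B) K | s in [set: R]] < eps%:E)%E.

Definition uniform_attractor (S : R -> R -> V3 -> V3) (K : set V3) : Prop :=
  [/\ compact K, uniformly_attracting S K &
      (forall C : set V3, compact C -> uniformly_attracting S C -> K `<=` C)].

Definition Pspace : set V2 := [set p | 0 < p.1 /\ 0 < p.2].

Definition rel_closure (P N : set V2) : set V2 :=
  [set x | P x /\ forall U : set V2, open U -> U x ->
                   exists y, (U `&` P) y /\ N y].
Definition rel_interior (P X : set V2) : set V2 :=
  [set x | P x /\ exists U : set V2, [/\ open U, U x & U `&` P `<=` X]].

Definition nowhere_dense_in (P N : set V2) : Prop :=
  N `<=` P /\ rel_interior P (rel_closure P N) = set0.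

Definition dense_in (P L : set V2) : Prop :=
  L `<=` P /\ P `<=` rel_closure P L.

Definition residual_in (P L : set V2) : Prop :=
  L `<=` P /\ exists N : nat -> set V2,
    (forall n, nowhere_dense_in P (N n)) /\ P `\` L = \bigcup_n N n.

Definition hcont_at (P : set V2) (F : V2 -> set V3) (p : V2) : Prop :=
  forall eps : R, 0 < eps -> exists delta : R, 0 < delta /\
    forall q, P q -> dist2 q p < delta -> (hausdorff (F q) (F p) < eps%:E)%E.

End Defs.

(* Main.v *)
(* Both attractor maps are upper semicontinuous at every parameter, and an
   upper semicontinuous compact-valued map into R^3 is lower semicontinuous off
   a countable union of nowhere dense sets (Fort): for every centre c and radius
   d the parameters whose value lies within d of c form a closed set, and lower
   semicontinuity can only fail on the frontiers of countably many of these.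

   Upper semicontinuity: a quadratic Lyapunov function gives an absorbing ball B
   that is uniform in the initial time and locally uniform in (sigma, b), and a
   Gronwall estimate shows that S_{sigma,b}(T+s,s)x depends continuously on
   (sigma, b), uniformly in s and x in B. By minimality the attractors at nearby
   parameters are contained in S(t,s)B, respectively in the closure of the union
   over s of S(T+s,s)B, which at the base parameter is already close to the
   attractor.

   One exceptional set serves all t: lower semicontinuity at the times -n
   propagates forward through A(t) = S(t,-n)A(-n). *)
Require Import Defs.
From HB Require Import structures.
From mathcomp Require Import all_boot all_order all_algebra.
From mathcomp Require Import all_classical all_reals all_analysis.
From mathcomp Require Import ring lra.
Import Order.TTheory GRing.Theory Num.Theory.
Import numFieldNormedType.Exports.
Local Open Scope classical_set_scope.
Local Open Scope ring_scope.

(** * Completeness of products of complete spaces *)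

Section ProductComplete.
Variables U V : completeType.

HB.instance Definition _ := Pointed.on (U * V)%type.

(** Baire's theorem is applied in the parameter plane, which must therefore be a complete space. The
    projections of a Cauchy filter are Cauchy, and the filter converges to the pair of their
    limits. *)
Lemma prod_complete (F : set_system (U * V)) : ProperFilter F ->
  cauchy F -> cvg F.
Proof.
move=> FF cF.
have /cauchy_cvg c1 : cauchy (fst @ F).
  move=> A entA.
  have /cF : entourage [set xy : (U * V) * (U * V) | A (xy.1.1, xy.2.1)].
    have := prod_entP entA (@entourageT V).
    by apply: filterS => x [].
  by move=> [[P Q] /= [FP FQ] PQ]; exists (fst @` P, fst @` Q) => /=;
     [split; [apply: filterS FP | apply: filterS FQ] => x Px /=; exists x
     |move=> [_ _] /= [[x Px <-] [y Qy <-]]; exact: (PQ (x, y))].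
have /cauchy_cvg c2 : cauchy (snd @ F).
  move=> A entA.
  have /cF : entourage [set xy : (U * V) * (U * V) | A (xy.1.2, xy.2.2)].
    have := prod_entP (@entourageT U) entA.
    by apply: filterS => x [].
  by move=> [[P Q] /= [FP FQ] PQ]; exists (snd @` P, snd @` Q) => /=;
     [split; [apply: filterS FP | apply: filterS FQ] => x Px /=; exists x
     |move=> [_ _] /= [[x Px <-] [y Qy <-]]; exact: (PQ (x, y))].
apply/cvg_ex; exists (lim (fst @ F), lim (snd @ F)).
move=> A [[P Q] /= [/c1 FP /c2 FQ] PQA].
apply: (@filterS _ F _ (fst @^-1` P `&` snd @^-1` Q)); last exact: filterI.
by move=> [a b] [/= Pa Qb]; exact: (PQA (a, b)).
Qed.

HB.instance Definition _ := Uniform_isComplete.Build (U * V)%type prod_complete.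

End ProductComplete.
HB.instance Definition _ (K : numFieldType) (U V : completeNormedModType K) :=
  Complete.on (U * V)%type.

(** * An affine Gronwall inequality *)

Section Gronwall.
Variable R : realType.
Implicit Types (w : R -> R) (s t K c : R).

(** The product of [w + c / K] and the integrating factor exp(-K (t - s)) has nonpositive
    derivative. Both signs of [K] occur: a negative rate gives dissipation, a positive one
    continuous dependence. *)
Lemma gronwall_affine w (w' : R -> R) s K c : K != 0 ->
  w t @[t --> s^'+] --> w s ->
  (forall t, s < t -> is_derive t 1 w (w' t)) ->
  (forall t, s < t -> w' t <= K * w t + c) ->
  forall t, s <= t -> w t <= (w s + c / K) * expR (K * (t - s)) - c / K.
Proof.
move=> K0 wc wd wle t st.
pose g := fun x : R => expR (- K * (x - s)).
pose h := fun x => (w x + c / K) * g x.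
have gd (x : R) : is_derive x 1 g (- K * g x).
  have -> : - K * g x = g x * - K by rewrite mulrC.
  have : is_derive x 1 (fun x : R => - K * (x - s)) (- K).
    apply: is_derive_eq.
    by rewrite subr0 /GRing.scale /= mulr1.
  move=> H; exact: (@is_derive1_comp _ expR (fun x : R => - K * (x - s))).
have hd (x : R) : s < x -> is_derive x 1 h ((w' x - (K * w x + c)) * g x).
  move=> sx; have := wd _ sx => wdx.
  have gdx := gd x.
  apply: is_derive_eq.
  rewrite /GRing.scale /=; field; exact: K0.
have hle : h t <= h s.
  apply: (@ler0_derive1_nincry _ h s) => // [x|x|].
  - by rewrite in_itv /= andbT => /hd [].
  - rewrite in_itv /= andbT => sx; have [_] := hd _ sx.
    rewrite derive1E => ->; rewrite mulr_le0_ge0 ?expR_ge0 // subr_le0.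
    exact: wle.
  - apply/continuous_within_itvcyP; split.
      move=> x; rewrite in_itv /= andbT => /hd [dx _].
      exact/differentiable_continuous/derivable1_diffP.
    apply: cvgM; first by apply: cvgD => //; exact: cvg_cst.
    apply: cvg_at_right_filter.
    have [dx _] := gd s.
    exact/differentiable_continuous/derivable1_diffP.
have hs : h s = w s + c / K by rewrite /h /g subrr mulr0 expR0 mulr1.
rewrite lerBrDr.
have -> : w t + c / K = h t * expR (K * (t - s)).
  by rewrite /h /g -mulrA -expRD mulNr addNr expR0 mulr1.
by rewrite -hs ler_pM2r ?expR_gt0.
Qed.

End Gronwall.

(** * Dissipativity and continuous dependence for the Lorenz system *)

Section LorenzSolutions.
Variable R : realType.
Implicit Types (r : R -> R) (u v : R -> V3 R) (s t m M Q : R).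

Definition normsq (v : V3 R) : R := v.1.1 ^+ 2 + v.1.2 ^+ 2 + v.2 ^+ 2.

(** The initial value is not prescribed, so a trajectory followed from a later time is again a
    solution in this sense. *)
Definition lorenz_solution r sigma b s u : Prop :=
  u t @[t --> s^'+] --> u s /\
  forall t, s < t ->
    is_derive t 1 (fun tau => (u tau).1.1)
      (- sigma * (u t).1.1 + sigma * (u t).1.2) /\
    is_derive t 1 (fun tau => (u tau).1.2)
      (r t * (u t).1.1 - (u t).1.2 - (u t).1.1 * (u t).2) /\
    is_derive t 1 (fun tau => (u tau).2)
      (- b * (u t).2 + (u t).1.1 * (u t).1.2).

Definition in_box m M (a : R) := m <= a /\ a <= M.

Lemma cvg_coordinates (F : set_system R) (FF : Filter F) u (l : V3 R) :
  u t @[t --> F] --> l ->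
  [/\ (u t).1.1 @[t --> F] --> l.1.1, (u t).1.2 @[t --> F] --> l.1.2 &
      (u t).2 @[t --> F] --> l.2].
Proof.
move=> h.
have h1 : (u t).1 @[t --> F] --> l.1 by apply: (cvg_comp _ _ h); exact: cvg_fst.
split.
- by apply: (cvg_comp _ _ h1); exact: cvg_fst.
- by apply: (cvg_comp _ _ h1); exact: cvg_snd.
- by apply: (cvg_comp _ _ h); exact: cvg_snd.
Qed.

Section Dissipativity.
Variables (r : R -> R) (R0 : R).
Hypothesis r_bd : forall t, `|r t| <= R0.
Let c := R0 ^+ 2 + 1.

(* The weights cancel the cubic terms and the [c * sigma * x * y] terms of the
   derivative, and [c > (sup |r|)^2] absorbs the remaining [r * x * y]; unlike
   the shift [z - sigma - r] this does not involve the derivative of [r]. *)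
Definition lyapunov sigma (v : V3 R) : R :=
  c * v.1.1 ^+ 2 + sigma * v.1.2 ^+ 2 + sigma * (v.2 - c) ^+ 2.

(** The three weighted squares are damped at rates sigma, 1 and b, all at least [m]. Hence the
    derivative is at most -m times [lyapunov] plus the constant M^2 c^2, and Gronwall applies with
    rate -m. *)
Lemma lyapunov_decay m M sigma b s u t : 0 < m -> m <= 1 ->
  in_box m M sigma -> in_box m M b -> lorenz_solution r sigma b s u -> s <= t ->
  lyapunov sigma (u t) <=
    lyapunov sigma (u s) * expR (- m * (t - s)) + M ^+ 2 * c ^+ 2 / m.
Proof.
move=> m0 m1 [ms sM] [mb bM] [uc ud] st.
have [xc yc zc] := cvg_coordinates _ _ _ _ uc.
set K := M ^+ 2 * c ^+ 2.
pose x := fun tau => (u tau).1.1; pose y := fun tau => (u tau).1.2.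
pose z := fun tau => (u tau).2.
pose w' := fun t : R => 2 * sigma * (- c * x t ^+ 2 + r t * (x t * y t) - y t ^+ 2
   - b * z t * (z t - c)).
have mN0 : - m != 0 by rewrite oppr_eq0 gt_eqF.
have := @gronwall_affine R (fun tau => lyapunov sigma (u tau)) w' s (- m) K mN0.
move=> /(_ _ _ _ _ st) H.
apply: (le_trans (H _ _ _)).
- rewrite /lyapunov.
  apply: cvgD; first apply: cvgD.
  + by apply: cvgM; [exact: cvg_cst|apply: cvgM].
  + by apply: cvgM; [exact: cvg_cst|apply: cvgM].
  + by apply: cvgM; [exact: cvg_cst|apply: cvgM; apply: cvgB => //; exact: cvg_cst].
- move=> tau stau; have [dx [dy dz]] := ud _ stau.
  rewrite /lyapunov -/x -/y -/z in dx dy dz *.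
  apply: is_derive_eq.
  by rewrite /w' /GRing.scale /= /x /y /z; ring.
- move=> tau stau; rewrite /w' /lyapunov -/(x tau) -/(y tau) -/(z tau).
  have rr := r_bd tau.
  have rc : r tau ^+ 2 <= c.
    rewrite /c -[r tau ^+ 2]ger0_norm ?sqr_ge0 // normrX.
    by apply: (@le_trans _ _ (R0 ^+ 2)); rewrite ?lerDl // lerXn2r ?nnegrE // (le_trans _ rr).
  have c1 : 1 <= c by rewrite /c lerDr sqr_ge0.
  move: (x tau) (y tau) (z tau) (r tau) rc c1 => X Y Z rt; rewrite /K.
  move: (c) => d rc d1.
  have h1 : 2 * (rt * (X * Y)) <= d * X ^+ 2 + Y ^+ 2.
    have : rt ^+ 2 * X ^+ 2 <= d * X ^+ 2 by rewrite ler_wpM2r ?sqr_ge0.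
    have := sqr_ge0 (rt * X - Y); nra.
  set W := Z - d.
  (* From 2 Z W = Z^2 + W^2 - d^2, after dropping the term in Z^2. *)
  have h2 : - (2 * (b * Z * W)) <= - (b * W ^+ 2) + b * d ^+ 2.
    have -> : Z = W + d by rewrite /W subrK.
    have : 0 <= b * (W + d) ^+ 2 by rewrite mulr_ge0 ?sqr_ge0 // (le_trans (ltW m0)).
    by nra.
  have s0 : 0 <= sigma by rewrite (le_trans (ltW m0)).
  have h3 : 2 * sigma * (- d * X ^+ 2 + rt * (X * Y) - Y ^+ 2 - b * Z * W) <=
      sigma * (- (d * X ^+ 2) - Y ^+ 2 - b * W ^+ 2 + b * d ^+ 2).
    have -> (a : R) : 2 * sigma * a = sigma * (2 * a) by ring.
    by apply: ler_wpM2l => //; lra.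
  apply: (le_trans h3).
  have h4 : m * (d * X ^+ 2) <= sigma * (d * X ^+ 2).
    by rewrite ler_wpM2r // mulr_ge0 ?sqr_ge0 // (le_trans ler01).
  have h5 : m * (sigma * Y ^+ 2) <= 1 * (sigma * Y ^+ 2).
    by rewrite ler_wpM2r // mulr_ge0 ?sqr_ge0.
  have h6 : m * (sigma * W ^+ 2) <= b * (sigma * W ^+ 2).
    by rewrite ler_wpM2r // mulr_ge0 ?sqr_ge0.
  have h7 : sigma * b * d ^+ 2 <= M ^+ 2 * d ^+ 2.
    by rewrite ler_wpM2r ?sqr_ge0 // expr2 ler_pM // (le_trans (ltW m0)).
  lra.
- rewrite invrN mulrN opprK lerD2r ler_wpM2r ?expR_ge0 // gerBl.
  by rewrite divr_ge0 ?(ltW m0) // mulr_ge0 ?sqr_ge0.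
Qed.

Lemma normsq_ge0 (v : V3 R) : 0 <= normsq v.
Proof. by rewrite /normsq !addr_ge0 // sqr_ge0. Qed.

(** [lyapunov] and [normsq] control each other up to constants that depend only on [R0], [m] and
    [M]; the [+ 1] pays for the shift of z by [c]. *)
Lemma normsq_decay m M : 0 < m -> m <= 1 -> exists C : R, 0 < C /\
  forall sigma b s u t, in_box m M sigma -> in_box m M b ->
    lorenz_solution r sigma b s u -> s <= t ->
    normsq (u t) <= C * (normsq (u s) + 1) * expR (- m * (t - s)) + C.
Proof.
move=> m0 m1.
have c1 : 1 <= c by rewrite /c lerDr sqr_ge0.
have c0 : 0 <= c by exact: le_trans ler01 c1.
(* No sign of [M] is known before a parameter in the box is given, and [C] must be positive in any
   case. *)
pose N := `|M|.
pose A := c + 2 * N + 2 * N * c ^+ 2.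
pose L := M ^+ 2 * c ^+ 2 / m.
have N0 : 0 <= N := normr_ge0 M.
have A0 : 0 <= A.
  by have := mulr_ge0 N0 (sqr_ge0 c); rewrite /A; lra.
have L0 : 0 <= L by rewrite /L divr_ge0 ?(ltW m0) // mulr_ge0 ?sqr_ge0.
exists (2 / m * A + 2 / m * L + 2 * c ^+ 2); split.
  apply: ltr_wpDl; last by rewrite mulr_gt0 // exprn_gt0 // (lt_le_trans ltr01).
  rewrite -mulrDr; apply: mulr_ge0; last exact: addr_ge0.
  by rewrite divr_ge0 // ltW.
move=> sigma b s u t bs bb us st.
have := lyapunov_decay _ _ _ _ _ _ _ m0 m1 bs bb us st.
have [ms sM] := bs.
have s0 : 0 <= sigma by rewrite (le_trans (ltW m0)).
have sN : sigma <= N by rewrite (le_trans sM) // ler_norm.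
have low (v : V3 R) : m * normsq v <= 2 * lyapunov sigma v + m * (2 * c ^+ 2).
  rewrite /normsq /lyapunov; case: v => -[x y] z /=.
  have h1 : m * x ^+ 2 <= c * x ^+ 2 by rewrite ler_wpM2r ?sqr_ge0 // (le_trans m1).
  have h2 : m * y ^+ 2 <= sigma * y ^+ 2 by rewrite ler_wpM2r ?sqr_ge0.
  have h3 : m * (z - c) ^+ 2 <= sigma * (z - c) ^+ 2 by rewrite ler_wpM2r ?sqr_ge0.
  have h4 : m * z ^+ 2 <= m * (2 * (z - c) ^+ 2 + 2 * c ^+ 2).
    by rewrite ler_wpM2l ?(ltW m0) //; have := sqr_ge0 (z - 2 * c); nra.
  have h5 : 0 <= c * x ^+ 2 by rewrite mulr_ge0 ?sqr_ge0.
  have h6 : 0 <= sigma * y ^+ 2 by rewrite mulr_ge0 ?sqr_ge0.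
  lra.
have upp (v : V3 R) : lyapunov sigma v <= A * (normsq v + 1).
  rewrite /normsq /lyapunov /A; case: v => -[x y] z /=.
  have h2 : sigma * y ^+ 2 <= N * y ^+ 2 by rewrite ler_wpM2r ?sqr_ge0.
  have h3 : sigma * (z - c) ^+ 2 <= N * (2 * z ^+ 2 + 2 * c ^+ 2).
    apply: ler_pM => //; first exact: sqr_ge0.
    by have := sqr_ge0 (z + c); nra.
  have hx := sqr_ge0 x; have hy := sqr_ge0 y; have hz := sqr_ge0 z.
  have hc := sqr_ge0 c.
  have := mulr_ge0 N0 hx; have := mulr_ge0 N0 hy; have := mulr_ge0 N0 hz.
  have := mulr_ge0 c0 hx; have := mulr_ge0 c0 hy; have := mulr_ge0 c0 hz.
  have := mulr_ge0 (mulr_ge0 N0 hc) hx; have := mulr_ge0 (mulr_ge0 N0 hc) hy.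
  have := mulr_ge0 (mulr_ge0 N0 hc) hz.
  lra.
set e := expR _ => dec.
have e0 : 0 <= e by exact: expR_ge0.
have h1 : lyapunov sigma (u s) * e <= A * (normsq (u s) + 1) * e.
  by rewrite ler_wpM2r.
have h2 : normsq (u t) <= 2 / m * (A * (normsq (u s) + 1) * e + L) + 2 * c ^+ 2.
  rewrite -(ler_pM2l m0).
  have -> : m * (2 / m * (A * (normsq (u s) + 1) * e + L) + 2 * c ^+ 2) =
    2 * (A * (normsq (u s) + 1) * e + L) + m * (2 * c ^+ 2) by field; rewrite gt_eqF.
  by apply: (le_trans (low _)); rewrite lerD2r ler_wpM2l // (le_trans dec) // lerD2r.
apply: (le_trans h2).
set n := normsq (u s); have n0 : 0 <= n by exact: normsq_ge0.
have m'0 : 0 <= 2 / m by rewrite divr_ge0 ?(ltW m0).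
set B := 2 / m * L + 2 * c ^+ 2.
have B0 : 0 <= B.
  by have := mulr_ge0 m'0 L0; have := sqr_ge0 c; rewrite /B; lra.
have h3 : 0 <= B * ((n + 1) * e) by rewrite mulr_ge0 // mulr_ge0 // addr_ge0.
have h4 : 0 <= 2 / m * A by rewrite mulr_ge0.
rewrite -(addrA (2 / m * A)) -/B.
have -> : 2 / m * (A * (n + 1) * e + L) + 2 * c ^+ 2 = 2 / m * A * ((n + 1) * e) + B.
  by rewrite /B; ring.
lra.
Qed.

Lemma uniformly_bounded m M D : 0 < m -> m <= 1 -> exists D' : R,
  forall sigma b s u t, in_box m M sigma -> in_box m M b ->
    lorenz_solution r sigma b s u -> normsq (u s) <= D -> s <= t ->
    normsq (u t) <= D'.
Proof.
move=> m0 m1; have [C [C0 dec]] := normsq_decay m M m0 m1.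
exists (C * (D + 1) + C) => sigma b s u t bs bb us uD st.
apply: (le_trans (dec _ _ _ _ _ bs bb us st)); rewrite lerD2r.
have n0 : 0 <= normsq (u s) + 1 by rewrite addr_ge0 // normsq_ge0.
apply: (@le_trans _ _ (C * (normsq (u s) + 1))).
  rewrite ler_piMr ?mulr_ge0 ?(ltW C0) // -[leRHS](expR0 R) ler_expR.
  by rewrite mulNr oppr_le0 mulr_ge0 ?(ltW m0) // subr_ge0.
by rewrite ler_wpM2l ?(ltW C0) // lerD2r.
Qed.

(** Since exp(y) >= 1 + y, after time X / m the contribution of the initial value is at most 1. So
    [rho = 1 + C] serves every [D], and only the waiting time depends on [D]. *)
Lemma uniformly_absorbing m M : 0 < m -> m <= 1 -> exists rho : R, 0 < rho /\
  forall D, exists T, 0 <= T /\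
  forall sigma b s u t, in_box m M sigma -> in_box m M b ->
    lorenz_solution r sigma b s u -> normsq (u s) <= D -> s + T <= t ->
    normsq (u t) <= rho.
Proof.
move=> m0 m1; have [C [C0 dec]] := normsq_decay m M m0 m1.
exists (1 + C); split=> [|D]; first by rewrite addr_gt0.
pose X := C * (`|D| + 1).
have X0 : 0 <= X by rewrite mulr_ge0 ?(ltW C0) // addr_ge0.
exists (X / m); split=> [|sigma b s u t bs bb us uD sTt].
  by rewrite divr_ge0 ?(ltW m0).
have Tt : X <= m * (t - s).
  by rewrite mulrC -ler_pdivrMr // lerBrDl.
have st : s <= t by rewrite (le_trans _ sTt) // lerDl divr_ge0 ?(ltW m0).
apply: (le_trans (dec _ _ _ _ _ bs bb us st)); rewrite lerD2r.
have h : C * (normsq (u s) + 1) <= expR (m * (t - s)).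
  apply: (@le_trans _ _ X).
    by rewrite ler_wpM2l ?(ltW C0) // lerD2r (le_trans uD) // ler_norm.
  apply: (le_trans Tt); apply: (le_trans _ (expR_ge1Dx _)).
  by rewrite lerDr.
by rewrite mulNr expRN ler_pdivrMr ?expR_gt0 // mul1r.
Qed.

Lemma normsq_coord (v : V3 R) Q : normsq v <= Q ->
  [/\ `|v.1.1| <= Q + 1, `|v.1.2| <= Q + 1 & `|v.2| <= Q + 1].
Proof.
have sq (x : R) : `|x| <= x ^+ 2 + 1.
  by rewrite -real_normK ?num_real //; have := sqr_ge0 (`|x| - 1); nra.
case: v => -[x y] z; rewrite /normsq /= => h.
have := sq x; have := sq y; have := sq z.
have := sqr_ge0 x; have := sqr_ge0 y; have := sqr_ge0 z.
by split; lra.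
Qed.

(** Add the nonnegative quantities (Q - a)(x + y)^2 and (Q + a)(x - y)^2. *)
Lemma bilinear_bound (a x y Q : R) : `|a| <= Q -> 2 * (a * (x * y)) <= Q * (x ^+ 2 + y ^+ 2).
Proof.
rewrite ler_norml => /andP[h1 h2].
have h3 : 0 <= (Q - a) * (x + y) ^+ 2 by rewrite mulr_ge0 ?sqr_ge0 ?subr_ge0.
have h4 : 0 <= (Q + a) * (x - y) ^+ 2.
  by rewrite mulr_ge0 ?sqr_ge0 // -(opprK a) subr_ge0 lerNl.
lra.
Qed.

(** Gronwall for the squared difference, with the parameter gap as a constant forcing. Only the
    elapsed time enters, so the estimate yields uniqueness as well as continuity in data and
    parameters that is uniform in [s]. *)
Lemma solutions_close m M D : 0 < m -> m <= 1 -> exists K : R, 0 < K /\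
  forall sigma b sigma' b' s u v t,
    in_box m M sigma -> in_box m M b -> in_box m M sigma' -> in_box m M b' ->
    lorenz_solution r sigma b s u -> lorenz_solution r sigma' b' s v ->
    normsq (u s) <= D -> normsq (v s) <= D -> s <= t ->
    normsq (u t - v t) <=
      (normsq (u s - v s) + ((sigma - sigma') ^+ 2 + (b - b') ^+ 2)) *
        expR (K * (t - s)).
Proof.
move=> m0 m1; have [D' bnd] := uniformly_bounded m M D m0 m1.
(* A common bound for sigma, r and all coordinates of both trajectories. *)
pose Q := `|M| + `|D'| + `|R0| + 1.
have Q0 : 0 < Q by rewrite /Q ltr_wpDl // !addr_ge0.
(* Six is the largest number of times that one square, that of [e1], occurs among the bounds [t1] to
   [t7] below. *)
exists (6 * Q); split=> [|sigma b sigma' b' s u v t bs bb bs' bb' us vs uD vD st].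
  by rewrite mulr_gt0.
have ub tau : s < tau -> [/\ `|(u tau).1.1| <= Q, `|(u tau).1.2| <= Q & `|(u tau).2| <= Q].
  move=> /ltW /(bnd _ _ _ _ _ bs bb us uD) /normsq_coord [h1 h2 h3].
  have := ler_norm D'; have : 0 <= `|M| by []; have : 0 <= `|R0| by [].
  by rewrite /Q; split; lra.
have vb tau : s < tau -> [/\ `|(v tau).1.1| <= Q, `|(v tau).1.2| <= Q & `|(v tau).2| <= Q].
  move=> /ltW /(bnd _ _ _ _ _ bs' bb' vs vD) /normsq_coord [h1 h2 h3].
  have := ler_norm D'; have : 0 <= `|M| by []; have : 0 <= `|R0| by [].
  by rewrite /Q; split; lra.
set eta := (sigma - sigma') ^+ 2 + (b - b') ^+ 2.
have [uc ud] := us; have [vc vd] := vs.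
have [u1c u2c u3c] := cvg_coordinates _ _ _ _ uc.
have [v1c v2c v3c] := cvg_coordinates _ _ _ _ vc.
pose x1 := fun tau => (u tau).1.1; pose y1 := fun tau => (u tau).1.2.
pose z1 := fun tau => (u tau).2.
pose x2 := fun tau => (v tau).1.1; pose y2 := fun tau => (v tau).1.2.
pose z2 := fun tau => (v tau).2.
pose w := fun tau => (x1 tau - x2 tau) ^+ 2 + (y1 tau - y2 tau) ^+ 2 + (z1 tau - z2 tau) ^+ 2.
pose w' := fun t : R =>
  2 * ((x1 t - x2 t) * (- sigma * x1 t + sigma * y1 t - (- sigma' * x2 t + sigma' * y2 t))
   + (y1 t - y2 t) * (r t * x1 t - y1 t - x1 t * z1 t - (r t * x2 t - y2 t - x2 t * z2 t))
   + (z1 t - z2 t) * (- b * z1 t + x1 t * y1 t - (- b' * z2 t + x2 t * y2 t))).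
have KN0 : 6 * Q != 0 by rewrite gt_eqF // mulr_gt0.
have := @gronwall_affine R w w' s (6 * Q) (6 * Q * eta) KN0.
move=> /(_ _ _ _ _ st) H.
have -> : normsq (u t - v t) = w t by [].
have -> : normsq (u s - v s) = w s by [].
apply: (@le_trans _ _ ((w s + (6 * Q * eta) / (6 * Q)) * expR (6 * Q * (t - s)) - (6 * Q * eta) / (6 * Q))).
  apply: H => [|tau stau|tau stau].
  - apply: cvgD; first apply: cvgD.
    + by apply: cvgM; apply: cvgB.
    + by apply: cvgM; apply: cvgB.
    + by apply: cvgM; apply: cvgB.
  - have [dx1 [dy1 dz1]] := ud _ stau; have [dx2 [dy2 dz2]] := vd _ stau.
    rewrite -/x1 -/y1 -/z1 in dx1 dy1 dz1; rewrite -/x2 -/y2 -/z2 in dx2 dy2 dz2.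
    rewrite /w.
    apply: is_derive_eq.
    by rewrite /w' /GRing.scale /= /x1 /x2 /y1 /y2 /z1 /z2; ring.
  - have [a1 a2 a3] := ub _ stau; have [b1 b2 b3] := vb _ stau.
    have rb : `|r tau| <= Q.
      have := r_bd tau; have := ler_norm R0.
      by have : 0 <= `|M| by []; have : 0 <= `|D'| by []; rewrite /Q; lra.
    have sb : `|sigma| <= Q.
      have [h1 h2] := bs; rewrite ger0_norm; last by rewrite (le_trans (ltW m0)).
      have := ler_norm M; have : 0 <= `|D'| by []; have : 0 <= `|R0| by [].
      by rewrite /Q; lra.
    have [ms _] := bs; have [mb _] := bb.
    rewrite /w' /w /eta.
    rewrite -/(x1 tau) -/(y1 tau) -/(z1 tau) in a1 a2 a3.
    rewrite -/(x2 tau) -/(y2 tau) -/(z2 tau) in b1 b2 b3.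
    move: (x1 tau) (y1 tau) (z1 tau) (x2 tau) (y2 tau) (z2 tau) (r tau) a1 a2 a3 b1 b2 b3 rb.
    move=> X1 Y1 Z1 X2 Y2 Z2 rt a1 a2 a3 b1 b2 b3 rb.
    set e1 := X1 - X2; set e2 := Y1 - Y2; set e3 := Z1 - Z2.
    set ds := sigma - sigma'; set db := b - b'.
    have N3 : `|- Z1| <= Q by rewrite normrN.
    have N2 : `|- X2| <= Q by rewrite normrN.
    have N4 : `|- Z2| <= Q by rewrite normrN.
    have t1 := bilinear_bound _ e1 e2 _ sb.
    have t2 := bilinear_bound _ e1 e2 _ rb.
    have t3 := bilinear_bound _ e1 e2 _ N3.
    have t4 := bilinear_bound _ e1 e3 _ a2.
    have t5 := bilinear_bound _ ds e1 _ N2.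
    have t6 := bilinear_bound _ ds e1 _ b2.
    have t7 := bilinear_bound _ db e3 _ N4.
    have p1 : 0 <= sigma * e1 ^+ 2 by rewrite mulr_ge0 ?sqr_ge0 // (le_trans (ltW m0)).
    have p3 : 0 <= b * e3 ^+ 2 by rewrite mulr_ge0 ?sqr_ge0 // (le_trans (ltW m0)).
    have p2 : 0 <= e2 ^+ 2 by exact: sqr_ge0.
    have q1 : 0 <= Q * e1 ^+ 2 by rewrite mulr_ge0 ?sqr_ge0 // ltW.
    have q2 : 0 <= Q * e2 ^+ 2 by rewrite mulr_ge0 ?sqr_ge0 // ltW.
    have q3 : 0 <= Q * e3 ^+ 2 by rewrite mulr_ge0 ?sqr_ge0 // ltW.
    have q4 : 0 <= Q * ds ^+ 2 by rewrite mulr_ge0 ?sqr_ge0 // ltW.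
    have q5 : 0 <= Q * db ^+ 2 by rewrite mulr_ge0 ?sqr_ge0 // ltW.
    (* The products are split as X1 Z1 - X2 Z2 = Z1 e1 + X2 e3 and X1 Y1 - X2 Y2 = Y1 e1 + X2 e2, so
       that the two terms X2 e2 e3 cancel. Every remaining term is a damping square or fits
       [bilinear_bound]. *)
    have id : 2 * (e1 * (- sigma * X1 + sigma * Y1 - (- sigma' * X2 + sigma' * Y2)) +
        e2 * (rt * X1 - Y1 - X1 * Z1 - (rt * X2 - Y2 - X2 * Z2)) +
        e3 * (- b * Z1 + X1 * Y1 - (- b' * Z2 + X2 * Y2))) =
      2 * (sigma * (e1 * e2)) + 2 * (rt * (e1 * e2)) + 2 * (- Z1 * (e1 * e2)) +
      2 * (Y1 * (e1 * e3)) + 2 * (- X2 * (ds * e1)) + 2 * (Y2 * (ds * e1)) +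
      2 * (- Z2 * (db * e3)) - 2 * (sigma * e1 ^+ 2) - 2 * e2 ^+ 2 - 2 * (b * e3 ^+ 2).
      by rewrite /e1 /e2 /e3 /ds /db; ring.
    rewrite id.
    lra.
have -> : 6 * Q * eta / (6 * Q) = eta by rewrite mulrC mulKf.
by rewrite gerBl addr_ge0 ?sqr_ge0.
Qed.

End Dissipativity.
End LorenzSolutions.

Arguments normsq {R} v.
Arguments in_box {R} m M a.
Arguments lorenz_solution {R} r sigma b s u.

(** * Euclidean distances, the product topology and the Hausdorff semidistance *)

Section Distances.
Variable R : realType.
Implicit Types (x y z : V3 R) (p q : V2 R) (A C : set (V3 R)) (e : R).

Lemma dist3E x y : dist3 x y = Num.sqrt (normsq (x - y)).
Proof. by []. Qed.

Lemma dist3xx x : dist3 x x = 0.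
Proof. by rewrite /dist3 !subrr expr0n /= !addr0 sqrtr0. Qed.

Lemma dist3C x y : dist3 x y = dist3 y x.
Proof. by rewrite /dist3; congr Num.sqrt; ring. Qed.

Lemma dist3_triangle y x z : dist3 x z <= dist3 x y + dist3 y z.
Proof.
rewrite !dist3E; have -> : x - z = (x - y) + (y - z) by rewrite addrA subrK.
move: (x - y) (y - z) => [[a1 a2] a3] [[b1 b2] b3].
set A := normsq (a1, a2, a3); set B := normsq (b1, b2, b3).
have A0 : 0 <= A := normsq_ge0 _ _; have B0 : 0 <= B := normsq_ge0 _ _.
rewrite -[leRHS]ger0_norm ?addr_ge0 ?sqrtr_ge0 // -sqrtr_sqr.
rewrite ler_wsqrtr // sqrrD !sqr_sqrtr //.
have CS : a1 * b1 + a2 * b2 + a3 * b3 <= Num.sqrt A * Num.sqrt B.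
  rewrite -sqrtrM //; apply: (le_trans (ler_norm _)).
  rewrite -sqrtr_sqr ler_wsqrtr // /A /B /normsq /=.
  (* Cauchy-Schwarz by Lagrange's identity: these squares sum to the defect. *)
  have := sqr_ge0 (a1 * b2 - a2 * b1); have := sqr_ge0 (a1 * b3 - a3 * b1).
  have := sqr_ge0 (a2 * b3 - a3 * b2); nra.
by move: CS; rewrite /normsq /A /B /normsq /= mulr2n; lra.
Qed.

Lemma dist3_le_coordinates x y :
  dist3 x y <= `|x.1.1 - y.1.1| + `|x.1.2 - y.1.2| + `|x.2 - y.2|.
Proof.
rewrite -[leRHS]ger0_norm ?addr_ge0 // -sqrtr_sqr ler_wsqrtr //.
rewrite -(real_normK (num_real (x.1.1 - y.1.1))) -(real_normK (num_real (x.1.2 - y.1.2))).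
rewrite -(real_normK (num_real (x.2 - y.2))).
move: `|_| `|_| `|_| (normr_ge0 (x.1.1 - y.1.1)) (normr_ge0 (x.1.2 - y.1.2)) (normr_ge0 (x.2 - y.2)).
move=> a b c a0 b0 c0.
by have := mulr_ge0 a0 b0; have := mulr_ge0 a0 c0; have := mulr_ge0 b0 c0; nra.
Qed.

Lemma near_dist3 x e : 0 < e -> \forall y \near x, dist3 x y < e.
Proof.
move=> e0; apply/nbhs_ballP; exists (e / 3) => /=; first by rewrite divr_gt0.
move=> y [[b1 b2] b3]; apply: (le_lt_trans (dist3_le_coordinates _ _)).
by move: b1 b2 b3; rewrite /ball /=; lra.
Qed.

Lemma near_dist2 p (Q : set (V2 R)) : nbhs p Q ->
  exists e : R, 0 < e /\ forall q, dist2 q p < e -> Q q.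
Proof.
move=> /nbhs_ballP[e /= e0 Qe]; exists e; split=> // q qe; apply: Qe.
have le (a b : R) : `|a| <= Num.sqrt (a ^+ 2 + b ^+ 2).
  by rewrite -sqrtr_sqr ler_wsqrtr // lerDl sqr_ge0.
split; rewrite /ball /= distrC; apply: le_lt_trans qe; rewrite /dist2 //.
by rewrite (addrC (_ ^+ 2)).
Qed.

Lemma near_sqdist2 p e : 0 < e ->
  \forall q \near p, (q.1 - p.1) ^+ 2 + (q.2 - p.2) ^+ 2 < e.
Proof.
move=> e0.
have c : (fun q : V2 R => (q.1 - p.1) ^+ 2 + (q.2 - p.2) ^+ 2) q @[q --> p] -->
    (p.1 - p.1) ^+ 2 + (p.2 - p.2) ^+ 2.
  apply: cvgD; apply: cvgM; apply: cvgB; try exact: cvg_cst;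
    by [exact: cvg_fst | exact: cvg_snd].
have near0 : nbhs ((p.1 - p.1) ^+ 2 + (p.2 - p.2) ^+ 2) [set x : R | x < e].
  rewrite !subrr expr0n /= addr0; exact: lt_nbhsl.
exact: (c _ near0).
Qed.

Lemma semidist_lt A C e : (semidist A C < e%:E)%E ->
  forall x, A x -> exists y, C y /\ dist3 x y < e.
Proof.
move=> sAC x Ax.
have : (dist_pt x C < e%:E)%E.
  by apply: le_lt_trans sAC; apply: ereal_sup_ubound; exists x.
by move=> /ereal_inf_lt[_ [y Cy <-]]; rewrite lte_fin; exists y.
Qed.

Lemma semidist_le A C e : (forall x, A x -> exists y, C y /\ dist3 x y <= e) ->
  (semidist A C <= e%:E)%E.
Proof.
move=> h; apply: ge_ereal_sup => _ [x Ax <-].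
have [y [Cy xy]] := h x Ax.
apply: (@le_trans _ _ (dist3 x y)%:E); last by rewrite lee_fin.
by apply: ereal_inf_lbound; exists y.
Qed.

End Distances.

(** * Generic continuity of upper semicontinuous set-valued maps *)

Section Semicontinuity.
Variable R : realType.
Implicit Types (P N : set (V2 R)) (F : V2 R -> set (V3 R)) (p q : V2 R).

Definition upper_semicontinuous_at P F p := forall e : R, 0 < e ->
  \forall q \near p, P q -> forall x, F q x -> exists y, F p y /\ dist3 x y < e.

Definition lower_semicontinuous_at P F p := forall e : R, 0 < e ->
  \forall q \near p, P q -> forall x, F p x -> exists y, F q y /\ dist3 x y < e.

Lemma semicontinuous_hcont P F p : upper_semicontinuous_at P F p ->
  lower_semicontinuous_at P F p -> hcont_at P F p.
Proof.
move=> uF lF e e0; have e20 : 0 < e / 2 by rewrite divr_gt0.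
have [d [d0 near_d]] := near_dist2 _ _ _ (filterI (uF _ e20) (lF _ e20)).
exists d; split=> // q Pq /near_d[/(_ Pq) uq /(_ Pq) lq].
apply: (@le_lt_trans _ _ (e / 2)%:E); last by rewrite lte_fin; lra.
rewrite ge_max; apply/andP; split; apply: semidist_le => x.
  by move=> /uq[y [Fy /ltW]]; exists y.
by move=> /lq[y [Fy /ltW]]; exists y.
Qed.

(* [q] is in [near_set P F c d] iff the distance from [c] to [F q] is at most
   [d]; it is relatively closed when [F] is upper semicontinuous. *)
Definition near_set P F (c : V3 R) (d : R) : set (V2 R) :=
  [set q | P q /\ forall e : R, 0 < e -> exists y, F q y /\ dist3 c y < d + e].

(** For a relatively closed [near_set], its frontier is what remains after removing the interior.
    Full neighbourhoods agree with relative ones because this is applied to open [P]. *)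
Definition near_set_frontier P F c d : set (V2 R) :=
  [set q | near_set P F c d q /\ ~ nbhs q (near_set P F c d)].

Lemma near_set_closed P F c d p : P p -> upper_semicontinuous_at P F p ->
  rel_closure P (near_set P F c d) p -> near_set P F c d p.
Proof.
move=> Pp uF [_ cl]; split=> // e e0.
have e20 : 0 < e / 2 by rewrite divr_gt0.
have := uF _ e20; rewrite /prop_near1 nbhsE => -[V [oV Vp] VF].
have [q [[Vq Pq] [_ /(_ _ e20)[y [Fy cy]]]]] := cl V oV Vp.
have [x [Fx yx]] := VF q Vq Pq y Fy.
exists x; split=> //; apply: (le_lt_trans (dist3_triangle _ y _ _)); lra.
Qed.

(** A relatively open set inside the closure of the frontier lies in the closed [near_set], hence in
    its interior; yet it would contain a frontier point. *)
Lemma near_set_frontier_nowhere_dense P F c d : open P ->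
  (forall p, P p -> upper_semicontinuous_at P F p) ->
  nowhere_dense_in P (near_set_frontier P F c d).
Proof.
move=> oP uF; split=> [q [[]]//|].
apply/seteqP; split=> // p [Pp [V [oV Vp VN]]].
have [_ /(_ V oV Vp)[q [[Vq Pq] [_ qN]]]] := VN p (conj Vp Pp).
apply: qN; apply: (@filterS _ _ _ (V `&` P)).
  move=> q' [Vq' Pq']; apply: near_set_closed => //; first exact: uF.
  have [_ cl] := VN q' (conj Vq' Pq').
  by split=> // W oW /(cl W oW)[z [WPz [Nz _]]]; exists z.
exact: (open_nbhs_nbhs (conj (openI oV oP) (conj Vq Pq))).
Qed.

Definition rational_point (c : rat * rat * rat) : V3 R :=
  (ratr c.1.1, ratr c.1.2, ratr c.2).

Lemma rational_point_dense (x : V3 R) (e : R) : 0 < e ->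
  exists c, dist3 x (rational_point c) < e.
Proof.
move=> e0.
have approx (a : R) : exists q : rat, `|a - ratr q| < e / 3.
  have : a < a + e / 3 by rewrite ltrDl divr_gt0.
  move=> /rat_in_itvoo[q]; rewrite in_itv /= => /andP[q1 q2].
  by exists q; rewrite ltr_norml; apply/andP; split; lra.
have [a xa] := approx x.1.1; have [b xb] := approx x.1.2.
have [c xc] := approx x.2; exists (a, b, c).
by apply: (le_lt_trans (dist3_le_coordinates _ _ _)) => /=; lra.
Qed.

(** Each x in [F p] has a rational point c close by, so p is in the [near_set] of c. Off the
    frontier, so are all nearby q, and [F q] has a point near c, hence near x. Compactness of [F p],
    in its near-covering form, gives one neighbourhood of p for all x. *)
Lemma lower_semicontinuous_off_frontiers P F p : P p -> compact (F p) ->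
  (forall c n, ~ near_set_frontier P F (rational_point c) n.+1%:R^-1 p) ->
  lower_semicontinuous_at P F p.
Proof.
move=> Pp /compact_near_coveringP cF offN e e0.
have near_all :=
  cF (V2 R) (nbhs p) (fun q x => P q -> exists y, F q y /\ dist3 x y < e) _.
suff : \forall q \near p, F p `<=` (fun x => P q -> exists y, F q y /\ dist3 x y < e).
  by apply: filterS => q h Pq x /h; exact.
apply: near_all => x Fx.
(* With k this inverse, the path from x' through x and c to y costs k + k + 2k. *)
have [n ne] : exists n, n.+1%:R^-1 < e / 4.
  exists (Num.truncn (e / 4)^-1).
  by rewrite -ltf_pV2 ?(posrE, divr_gt0) // invrK Num.Theory.truncnS_gt.
have n0 : 0 < n.+1%:R^-1 :> R by rewrite invr_gt0.
have [c xc] := rational_point_dense x _ n0.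
have : near_set P F (rational_point c) n.+1%:R^-1 p.
  split=> // d d0; exists x; split=> //.
  by rewrite dist3C; apply: (lt_trans xc); rewrite ltrDl.
move=> Np; have /contrapT Nnear : ~ ~ nbhs p (near_set P F (rational_point c) n.+1%:R^-1).
  by move=> h; exact: (offN c n).
exists ([set x' | dist3 x x' < n.+1%:R^-1], near_set P F (rational_point c) n.+1%:R^-1).
  by split=> //; exact: near_dist3.
move=> [x' q] /= [xx' [_ /(_ _ n0)[y [Fy cy]]]] Pq; exists y; split=> //.
have := dist3_triangle _ x x' y; have := dist3_triangle _ (rational_point c) x y.
rewrite (dist3C _ x' x).
by move: (n.+1%:R^-1) ne xc cy xx' => k; lra.
Qed.

(** Passes from the relative notion to the open dense sets of Baire's theorem. An open set inside
    [closure N] meets [N], and at such a point, which is in [P], it would witness a relative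
    interior. *)
Lemma nowhere_dense_complement P N : open P -> nowhere_dense_in P N ->
  open (~` closure N) /\ dense (~` closure N : set (V2 R)).
Proof.
move=> oP [NP N0]; split; first exact/closed_openC/closed_closure.
move=> V [p Vp] oV; apply: contrapT => disj.
have VN : V `<=` closure N.
  by move=> q Vq; apply: contrapT => qN; apply: disj; exists q.
have [q [Nq Vq]] := VN p Vp V (open_nbhs_nbhs (conj oV Vp)).
suff : rel_interior P (rel_closure P N) q by rewrite N0.
split; first exact: NP.
exists V; split=> // q' [Vq' Pq']; split=> // W oW Wq'.
have [y [Ny Wy]] := VN q' Vq' W (open_nbhs_nbhs (conj oW Wq')).
by exists y; split=> //; split=> //; exact: NP.
Qed.

(** As [P] is open, Baire's theorem in the whole plane can be tested on the open set [V]&[P]. *)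
Lemma residual_dense P L : open P -> residual_in P L -> dense_in P L.
Proof.
move=> oP [LP [N [Nnd PL]]]; split=> // p Pp; split=> // V oV Vp.
have [|q [[Vq Pq] qN]] := @Baire R (V2 R) (fun n => ~` closure (N n))
  (fun n => nowhere_dense_complement _ _ oP (Nnd n)) (V `&` P) _ (openI oV oP).
  by exists p.
exists q; split=> //; apply: contrapT => nLq.
have : (P `\` L) q by [].
by rewrite PL => -[n _ Nq]; apply: (qN n) => //; exact: subset_closure.
Qed.

Lemma generic_lower_semicontinuity P (I : countType) (F : I -> V2 R -> set (V3 R)) :
  open P -> (forall i p, P p -> compact (F i p)) ->
  (forall i p, P p -> upper_semicontinuous_at P (F i) p) ->
  exists L, residual_in P L /\
    forall p, L p -> forall i, lower_semicontinuous_at P (F i) p.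
Proof.
move=> oP cF uF.
(* One sequence enumerates the frontiers for all maps, centres and radii; numbers that code no
   triple give the empty set. *)
pose N n := if @unpickle (I * (rat * rat * rat) * nat)%type n is Some (i, c, k)
  then near_set_frontier P (F i) (rational_point c) k.+1%:R^-1 else set0.
exists (P `\` \bigcup_n N n); split; last first.
  move=> p [Pp pN] i; apply: lower_semicontinuous_off_frontiers => // [|c k Np].
    exact: cF.
  apply: pN; exists (pickle (i, c, k)) => //.
  by rewrite /N pickleK.
have Nnd n : nowhere_dense_in P (N n).
  rewrite /N; case: unpickle => [[[i c] k]|].
    by apply: near_set_frontier_nowhere_dense => // p; exact: uF.
  split=> //; apply/seteqP; split=> // p [Pp [V [oV Vp VN]]].
  have [_ cl] := VN p (conj Vp Pp).
  by have [q [_ []]] := cl V oV Vp.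
split; first by move=> p [].
exists N; split=> //; apply/seteqP; split=> p.
  by move=> [Pp nL]; apply: contrapT => pN; apply: nL.
move=> [n _ Np]; split; first exact: (Nnd n).1.
by move=> [_]; apply; exists n.
Qed.

End Semicontinuity.

(** * Semicontinuity of the attractors in the parameters *)

Section Attractors.
Variables (R : realType) (r : R -> R) (R0 : R).
Hypothesis r_bd : forall t, `|r t| <= R0.
Implicit Types (sigma b s t m M rho e : R) (p q : V2 R) (x a : V3 R).

(** At a later initial time, right-continuity follows from differentiability there. *)
Lemma lorenz_solution_restrict sigma b s s' (u : R -> V3 R) : s <= s' ->
  lorenz_solution r sigma b s u -> lorenz_solution r sigma b s' u.
Proof.
rewrite le_eqVlt => /orP[/eqP -> //|ss' [_ ud]].
split; last by move=> t s't; apply: ud; exact: lt_trans s't.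
have cts (f : R -> R) (df : R) : is_derive s' 1 f df -> f t @[t --> s'^'+] --> f s'.
  move=> [fd _]; apply: cvg_at_right_filter.
  exact/differentiable_continuous/derivable1_diffP.
have [/cts d1 [/cts d2 /cts d3]] := ud _ ss'.
have : ((u t).1.1, (u t).1.2, (u t).2) @[t --> s'^'+] -->
    ((u s').1.1, (u s').1.2, (u s').2).
  apply: (@cvg_pair _ _ _ _ (nbhs ((u s').1.1, (u s').1.2)) (nbhs (u s').2)) => //.
  exact: (@cvg_pair _ _ _ _ (nbhs (u s').1.1) (nbhs (u s').1.2)).
rewrite -!surjective_pairing; apply: cvg_trans.
by apply: near_eq_cvg; near=> t; rewrite -!surjective_pairing.
Unshelve. all: by end_near.
Qed.

Definition ball0 rho : set (V3 R) := [set x | normsq x <= rho].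

Lemma bounded3_ball0 (B : set (V3 R)) : bounded3 B -> exists D, B `<=` ball0 D.
Proof.
move=> [D BD]; exists (D ^+ 2) => x /BD.
rewrite /dist3 /= !subr0 -/(normsq x) => xD.
rewrite /ball0 /= -(sqr_sqrtr (normsq_ge0 _ x)) lerXn2r ?nnegrE ?sqrtr_ge0 //.
exact: le_trans xD.
Qed.

Lemma ball0_bounded3 rho : bounded3 (ball0 rho).
Proof.
exists (Num.sqrt rho) => x xrho.
by rewrite /dist3 /= !subr0 -/(normsq x) ler_wsqrtr.
Qed.

Lemma closed_ball0 rho : closed (ball0 rho).
Proof.
have c1 : continuous (fun x : V3 R => x.1.1).
  by move=> x; apply: (cvg_comp (@fst _ _) (@fst _ _)); exact: cvg_fst.
have c2 : continuous (fun x : V3 R => x.1.2).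
  by move=> x; apply: (cvg_comp (@fst _ _) (@snd _ _)); [exact: cvg_fst|exact: cvg_snd].
have c3 : continuous (fun x : V3 R => x.2) by move=> x; exact: cvg_snd.
have cN : continuous (@normsq R).
  move=> x; apply: cvgD; first apply: cvgD; apply: cvgM;
    by [exact: c1|exact: c2|exact: c3].
exact: (@preimage_closed _ _ (@normsq R) [set y : R | y <= rho] _ (@closed_le R rho)).
Qed.

Lemma compact_ball0 rho : compact (ball0 rho).
Proof.
pose I := `[- (rho + 1), rho + 1]%classic.
have cI : compact I by exact: segment_compact.
apply: (subclosed_compact (closed_ball0 rho) (compact_setX (compact_setX cI cI) cI)).
move=> x /normsq_coord[]; rewrite !ler_norml => h1 h2 h3.
by split; [split|]; rewrite /I /= in_itv.
Qed.

Lemma locally_in_box p : Pspace p -> exists m M, [/\ 0 < m, m <= 1 &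
  \forall q \near p, in_box m M q.1 /\ in_box m M q.2].
Proof.
(* The cap 1 is the damping rate of y. A radius at most half of each coordinate and at most 1 keeps
   both bounds valid nearby. *)
move=> [p1 p2]; exists (Num.min 1 (Num.min (p.1 / 2) (p.2 / 2))), (p.1 + p.2 + 1).
split; first by rewrite !lt_min ltr01 !divr_gt0.
  by rewrite ge_min lexx.
have e0 : 0 < Num.min (p.1 / 2) (Num.min (p.2 / 2) 1).
  by rewrite !lt_min ltr01 !divr_gt0.
apply/nbhs_ballP; exists (Num.min (p.1 / 2) (Num.min (p.2 / 2) 1)) => // q [].
rewrite /ball /= !lt_min => /and3P[a1 a2 a3] /and3P[b1 b2 b3].
move: a1 a2 a3 b1 b2 b3; rewrite !ltr_norml.
move=> /andP[a1 a1'] /andP[a2 a2'] /andP[a3 a3'] /andP[b1 b1'] /andP[b2 b2'] /andP[b3 b3'].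
have h1 : p.1 / 2 <= q.1 by lra.
have h2 : p.2 / 2 <= q.2 by lra.
rewrite /in_box !ge_min h1 h2 !orbT.
by split; split=> //; lra.
Qed.

Variable S : R -> R -> R -> R -> V3 R -> V3 R.
Hypothesis hS : forall sigma b, 0 < sigma -> 0 < b -> lorenz_process r sigma b (S sigma b).

Lemma process_start sigma b s x : 0 < sigma -> 0 < b -> S sigma b s s x = x.
Proof. by move=> s0 b0; have [] := hS _ _ s0 b0 s x. Qed.

Lemma process_solution sigma b s x : 0 < sigma -> 0 < b ->
  lorenz_solution r sigma b s (fun t => S sigma b t s x).
Proof.
by move=> s0 b0; have [e [c d]] := hS _ _ s0 b0 s x; split; rewrite ?e.
Qed.

(** [lorenz_process] describes each trajectory separately; the cocycle law is uniqueness. Both sides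
    solve the system from [y] at time s', so [solutions_close] bounds their distance by 0. *)
Lemma process_cocycle sigma b s s' t x : 0 < sigma -> 0 < b -> s <= s' -> s' <= t ->
  S sigma b t s x = S sigma b t s' (S sigma b s' s x).
Proof.
move=> s0 b0 sq qt.
have [m [M [m0 m1 /nbhs_singleton [/= bs bb]]]] := locally_in_box (sigma, b) (conj s0 b0).
set y := S sigma b s' s x.
have [K [_ /(_ sigma b sigma b s' _ _ t bs bb bs bb)]] :=
  solutions_close _ _ _ r_bd m M (normsq y) m0 m1.
move=> /(_ _ _ (lorenz_solution_restrict _ _ _ _ _ sq (process_solution _ _ s x s0 b0))
  (process_solution _ _ s' y s0 b0)).
rewrite process_start // => /(_ (lexx _) (lexx _) qt).
rewrite !subrr expr0n /= addr0 /normsq /= !expr0n /= !addr0 mul0r.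
move: (S sigma b t s x) (S sigma b t s' y) => [[a1 a2] a3] [[c1 c2] c3] /= h.
have n1 := sqr_ge0 (a1 - c1); have n2 := sqr_ge0 (a2 - c2).
have n3 := sqr_ge0 (a3 - c3).
have eq0 (d : R) : d ^+ 2 <= 0 -> d = 0.
  by move=> d2; apply/eqP; rewrite -sqrf_eq0 eq_le d2 sqr_ge0.
have /eq0 /subr0_eq -> : (a1 - c1) ^+ 2 <= 0 by lra.
have /eq0 /subr0_eq -> : (a2 - c2) ^+ 2 <= 0 by lra.
by have /eq0 /subr0_eq -> : (a3 - c3) ^+ 2 <= 0 by lra.
Qed.

Lemma process_continuity p rho T e : Pspace p -> 0 < e ->
  exists d : R, 0 < d /\ \forall q \near p, forall s t x y,
    normsq x <= rho -> normsq y <= rho -> dist3 x y < d -> s <= t -> t <= s + T ->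
    dist3 (S q.1 q.2 t s x) (S p.1 p.2 t s y) < e.
Proof.
move=> Pp e0; have [p1 p2] := Pp.
have [m [M [m0 m1 nbox]]] := locally_in_box p Pp.
have [bp1 bp2] := nbhs_singleton nbox.
have [K [K0 close]] := solutions_close _ _ _ r_bd m M rho m0 m1.
(* The budget e^2 is shared equally between the gap in initial data and the gap in parameters, each
   amplified by at most exp(K T). *)
pose f := e ^+ 2 / (2 * expR (K * T)).
have f0 : 0 < f by rewrite divr_gt0 ?exprn_gt0 ?mulr_gt0 ?expR_gt0.
exists (Num.sqrt f); split; first by rewrite sqrtr_gt0.
apply: (@filterS _ (nbhs p) _ _ _ _ (filterI nbox (near_sqdist2 _ p _ f0))) => q [[bq1 bq2] qp] s t x y xr yr xy st tT.
have q1 : 0 < q.1 by apply: lt_le_trans bq1.1.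
have q2 : 0 < q.2 by apply: lt_le_trans bq2.1.
have := close _ _ _ _ s _ _ t bq1 bq2 bp1 bp2 (process_solution _ _ s x q1 q2)
  (process_solution _ _ s y p1 p2).
rewrite !process_start // => /(_ xr yr st) h.
have xyf : normsq (x - y) < f.
  by move: xy; rewrite dist3E ltr_sqrt.
rewrite dist3E -[ltRHS]ger0_norm ?(ltW e0) // -sqrtr_sqr ltr_sqrt ?exprn_gt0 //.
apply: (le_lt_trans h).
have -> : e ^+ 2 = (f + f) * expR (K * T).
  by rewrite /f; field; rewrite gt_eqF ?expR_gt0.
apply: (@le_lt_trans _ _ ((normsq (x - y) + ((q.1 - p.1) ^+ 2 + (q.2 - p.2) ^+ 2)) * expR (K * T))).
  rewrite ler_wpM2l ?addr_ge0 ?sqr_ge0 ?normsq_ge0 // ler_expR ler_wpM2l ?(ltW K0) //.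
  by rewrite lerBlDl.
by rewrite ltr_pM2r ?expR_gt0 // ltrD.
Qed.

Section FixedParameters.
Variables (m M rho : R).
Hypotheses (m0 : 0 < m) (m1 : m <= 1).
Hypothesis absorbing : forall D, exists T, 0 <= T /\
  forall sigma b s u t, in_box m M sigma -> in_box m M b ->
    lorenz_solution r sigma b s u -> normsq (u s) <= D -> s + T <= t ->
    normsq (u t) <= rho.
Variables (sigma b : R).
Hypotheses (bs : in_box m M sigma) (bb : in_box m M b).
Let s0 : 0 < sigma := lt_le_trans m0 bs.1.
Let b0 : 0 < b := lt_le_trans m0 bb.1.

Lemma semidist_subset (A C : set (V3 R)) e : 0 < e -> A `<=` C ->
  (semidist A C < e%:E)%E.
Proof.
move=> e0 AC; apply: (@le_lt_trans _ _ (e / 2)%:E); last by rewrite lte_fin; lra.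
apply: semidist_le => x Ax; exists x; split; first exact: AC.
by rewrite dist3xx divr_ge0 ?(ltW e0).
Qed.

(** Minimality against the constant family [ball0 rho]. The radius is fixed by the box, so one ball
    holds the attractors of all its parameters. *)
Lemma pullback_attractor_sub_ball (A : R -> set (V3 R)) t :
  pullback_attractor (S sigma b) A -> A t `<=` ball0 rho.
Proof.
move=> [_ _ _ minA]; apply: (minA (fun _ => ball0 rho)).
  by move=> _; exact: compact_ball0.
move=> B /bounded3_ball0[D BD] {}t e e0.
have [T [T0 absT]] := absorbing D.
exists (t - T) => s sT st; apply: semidist_subset => // _ [x Bx <-].
apply: (absT _ _ _ _ _ bs bb (process_solution _ _ s x s0 b0)); last by lra.
by rewrite process_start //; exact: BD.
Qed.

(** Replaces the invariance available for pullback attractors. The closure attracts because a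
    trajectory that has entered the absorbing ball can be followed for exactly [T0] more; it is
    compact because trajectories from the ball stay bounded. *)
Lemma uniform_attractor_sub_closure (K : set (V3 R)) T0 : 0 <= T0 ->
  uniform_attractor (S sigma b) K ->
  K `<=` closure [set S sigma b (T0 + sx.1) sx.1 sx.2 | sx in [set sx | ball0 rho sx.2]].
Proof.
move=> T00 [_ _ minK]; set E := (X in closure X); apply: minK.
  have [D' bnd] := uniformly_bounded _ _ _ r_bd m M rho m0 m1.
  apply: (subclosed_compact (@closed_closure _ _) (compact_ball0 D')).
  apply: subset_trans (@closed_ball0 D'); apply: closure_subset => _ [[s x] /= xrho <-].
  apply: (bnd _ _ _ _ _ bs bb (process_solution _ _ s x s0 b0)); last by lra.
  by rewrite process_start.
move=> B /bounded3_ball0[D BD] e e0.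
have [T [TT absT]] := absorbing D.
exists (T + T0) => t Tt; have e20 : 0 < e / 2 by rewrite divr_gt0.
apply: (@le_lt_trans _ _ (e / 2)%:E); last by rewrite lte_fin; lra.
apply: ge_ereal_sup => _ [s _ <-]; apply/ltW/semidist_subset => // _ [x Bx <-].
(* The restart time lies [T0] before the final time t + s, and at least [T] after s, hence inside
   the absorbing ball. *)
apply: subset_closure; exists (t - T0 + s, S sigma b (t - T0 + s) s x) => /=.
  apply: (absT _ _ _ _ _ bs bb (process_solution _ _ s x s0 b0)); last by lra.
  by rewrite process_start //; exact: BD.
have -> : T0 + (t - T0 + s) = t + s by ring.
by rewrite -process_cocycle //; lra.
Qed.

End FixedParameters.

(** The time s is chosen by attraction at [p] alone. By invariance a point of the attractor at q is
    S_q(t,s)a with a in the ball; S_p(t,s)a is close to it by continuity and close to the attractor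
    at [p] by attraction. *)
Lemma pullback_attractor_usc (A : R -> R -> R -> set (V3 R)) t p :
  (forall sigma b, 0 < sigma -> 0 < b -> pullback_attractor (S sigma b) (A sigma b)) ->
  Pspace p -> upper_semicontinuous_at R (@Pspace R) (fun q => A q.1 q.2 t) p.
Proof.
move=> hA Pp e e0; have [p1 p2] := Pp.
have [m [M [m0 m1 nbox]]] := locally_in_box p Pp.
have [rho [_ absorbing]] := uniformly_absorbing _ _ _ r_bd m M m0 m1.
have e20 : 0 < e / 2 by rewrite divr_gt0.
have [_ _ attrA _] := hA _ _ p1 p2.
have [s1 /(_ (Num.min s1 t))] := attrA _ (ball0_bounded3 rho) t _ e20.
rewrite !ge_min !lexx orbT => /(_ isT isT).
set s := Num.min s1 t => attr.
have st : s <= t by rewrite ge_min lexx orbT.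
have [d [d0 close]] := process_continuity p rho (t - s) _ Pp e20.
apply: (@filterS _ (nbhs p) _ _ _ _ (filterI nbox close)) => q [[bq1 bq2] {}close] [q1 q2] x Ax.
have [_ invA _ _] := hA _ _ q1 q2.
move: Ax; rewrite -(invA t s st) => -[a Aa <-].
have arho : ball0 rho a.
  exact: (pullback_attractor_sub_ball m M rho m0 absorbing _ _ bq1 bq2 _ s (hA _ _ q1 q2)).
have [|y [Ay ay]] := semidist_lt _ _ _ _ attr (S p.1 p.2 t s a); first by exists a.
exists y; split=> //; apply: (le_lt_trans (dist3_triangle _ (S p.1 p.2 t s a) _ _)).
have := close s t a a arho arho; rewrite dist3xx subrKC => /(_ d0 st (lexx _)).
lra.
Qed.

Lemma uniform_attractor_usc (U : R -> R -> set (V3 R)) p :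
  (forall sigma b, 0 < sigma -> 0 < b -> uniform_attractor (S sigma b) (U sigma b)) ->
  Pspace p -> upper_semicontinuous_at R (@Pspace R) (fun q => U q.1 q.2) p.
Proof.
move=> hU Pp e e0; have [p1 p2] := Pp.
have [m [M [m0 m1 nbox]]] := locally_in_box p Pp.
have [rho [_ absorbing]] := uniformly_absorbing _ _ _ r_bd m M m0 m1.
(* The thirds pay for approximating a point of the closure, for changing the parameter, and for
   attraction at [p]. *)
have e30 : 0 < e / 3 by rewrite divr_gt0.
have [_ attrU _] := hU _ _ p1 p2.
have [T1 /(_ (Num.max T1 0))] := attrU _ (ball0_bounded3 rho) _ e30.
rewrite !le_max !lexx => /(_ isT).
set T := Num.max T1 0 => attr.
have T0 : 0 <= T by rewrite le_max lexx orbT.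
have [d [d0 close]] := process_continuity p rho T _ Pp e30.
apply: (@filterS _ (nbhs p) _ _ _ _ (filterI nbox close)) => q [[bq1 bq2] {}close] [q1 q2] x Ux.
have clx := uniform_attractor_sub_closure m M rho m0 m1 absorbing _ _ bq1 bq2 _ T T0
  (hU _ _ q1 q2) x Ux.
have [_ [[[s a] /= arho <-] xa]] := clx _ (near_dist3 _ x _ e30).
have : (semidist (S p.1 p.2 (T + s) s @` ball0 rho) (U p.1 p.2) < (e / 3)%:E)%E.
  by apply: le_lt_trans attr; apply: ereal_sup_ubound; exists s.
move=> /(semidist_lt _ _ _ _)/(_ (S p.1 p.2 (T + s) s a))[]; first by exists a.
move=> y [Uy ay]; exists y; split=> //.
have := close s (T + s) a a arho arho; rewrite dist3xx (addrC T) => /(_ d0).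
rewrite lerDl => /(_ T0 (lexx _)).
have := dist3_triangle _ (S q.1 q.2 (s + T) s a) x y.
have := dist3_triangle _ (S p.1 p.2 (s + T) s a) (S q.1 q.2 (s + T) s a) y.
move: xa ay; rewrite (addrC T) /=; lra.
Qed.

(** By invariance a point at time t comes from some a at time s; a nearby a' in the attractor at q
    is carried forward by S_q, and joint continuity in data and parameters keeps the images
    close. *)
Lemma pullback_attractor_lsc_forward (A : R -> R -> R -> set (V3 R)) s t p :
  (forall sigma b, 0 < sigma -> 0 < b -> pullback_attractor (S sigma b) (A sigma b)) ->
  Pspace p -> s <= t ->
  lower_semicontinuous_at R (@Pspace R) (fun q => A q.1 q.2 s) p ->
  lower_semicontinuous_at R (@Pspace R) (fun q => A q.1 q.2 t) p.
Proof.
move=> hA Pp st lscA e e0; have [p1 p2] := Pp.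
have [m [M [m0 m1 nbox]]] := locally_in_box p Pp.
have [rho [_ absorbing]] := uniformly_absorbing _ _ _ r_bd m M m0 m1.
have [bp1 bp2] := nbhs_singleton nbox.
have [d [d0 close]] := process_continuity p rho (t - s) _ Pp e0.
apply: (@filterS _ (nbhs p) _ _ _ _ (filterI nbox (filterI (lscA _ d0) close))).
move=> q [[bq1 bq2] [lsc {}close]] Pq x; have [q1 q2] := Pq.
have [_ invAp _ _] := hA _ _ p1 p2; have [_ invAq _ _] := hA _ _ q1 q2.
rewrite -(invAp t s st) => -[a Aa <-].
have [a' [Aa' aa']] := lsc Pq a Aa.
exists (S q.1 q.2 t s a'); split; first by rewrite -(invAq t s st); exists a'.
rewrite dist3C; apply: close => //; last by rewrite subrKC.
- exact: (pullback_attractor_sub_ball m M rho m0 absorbing _ _ bq1 bq2 _ s (hA _ _ q1 q2)).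
- exact: (pullback_attractor_sub_ball m M rho m0 absorbing _ _ bp1 bp2 _ s (hA _ _ p1 p2)).
- by rewrite dist3C.
Qed.

End Attractors.

(** * Conclusion for the attractor maps *)

Lemma open_Pspace (R : realType) : open (@Pspace R).
Proof.
have -> : @Pspace R = (fst @^-1` [set x | 0 < x]) `&` (snd @^-1` [set x | 0 < x]) by [].
by apply: openI; apply: open_comp; rewrite ?open_gt // => x _;
  [exact: cvg_fst | exact: cvg_snd].
Qed.

Theorem theorem6p3 (R : realType) (r : R -> R) (R0 : R)
  (r_der : forall t, derivable r t 1)
  (r'_cont : continuous (derive1 r))
  (r_bd : forall t, `|r t| <= R0 /\ `|derive1 r t| <= R0)
  (S : R -> R -> R -> R -> V3 R -> V3 R)
  (hS : forall sigma b, 0 < sigma -> 0 < b -> lorenz_process r sigma b (S sigma b))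
  (A : R -> R -> R -> set (V3 R))
  (hA : forall sigma b, 0 < sigma -> 0 < b -> pullback_attractor (S sigma b) (A sigma b))
  (U : R -> R -> set (V3 R))
  (hU : forall sigma b, 0 < sigma -> 0 < b -> uniform_attractor (S sigma b) (U sigma b)) :
  exists L : set (V2 R),
    [/\ residual_in (@Pspace R) L, dense_in (@Pspace R) L &
        forall p, L p ->
          (forall t, hcont_at (@Pspace R) (fun q => A q.1 q.2 t) p) /\
          hcont_at (@Pspace R) (fun q => U q.1 q.2) p].
Proof.
have r_bd' t : `|r t| <= R0 by have [] := r_bd t.
(* [None] stands for the uniform attractor, [Some n] for the pullback attractor at time -n, so a
   single residual set handles both. *)
pose F (i : option nat) (q : V2 R) : set (V3 R) :=
  if i is Some n then A q.1 q.2 (- n%:R) else U q.1 q.2.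
have [|||L [resL lscL]] := generic_lower_semicontinuity R (@Pspace R) (option nat : countType) F.
- exact: open_Pspace.
- move=> [n|] p [p1 p2]; first by have [cA _ _ _] := hA _ _ p1 p2; exact: cA.
  by have [] := hU _ _ p1 p2.
- move=> [n|] p Pp; first exact: (pullback_attractor_usc _ _ _ r_bd' S hS A).
  exact: (uniform_attractor_usc _ _ _ r_bd' S hS U).
exists L; split=> //; first exact/residual_dense/resL/open_Pspace.
move=> p Lp; have Pp : Pspace p by have [LP _] := resL; exact: LP.
split=> [t|]; apply: semicontinuous_hcont.
- exact: (pullback_attractor_usc _ _ _ r_bd' S hS A).
(* The successor makes n exceed |t|, so -n lies before t and lower semicontinuity can be carried
   forward. *)
- pose n := (Num.truncn `|t|).+1.
  apply: (pullback_attractor_lsc_forward _ _ _ r_bd' S hS A (- n%:R) t p hA Pp).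
    have := Num.Theory.truncnS_gt `|t|; have := ler_norm (- t).
    by rewrite normrN -/n; lra.
  exact: (lscL p Lp (Some n)).
- exact: (uniform_attractor_usc _ _ _ r_bd' S hS U).
- exact: (lscL p Lp None).
Qed.
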